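(* Let $(S,\rho)$ be a separable bounded metric space with $\mathrm{diam}(S)>0$ and with a Borel measure $\nu$ such that $\nu(S)<\infty$. Let $(X,Y)$ be a random pair with values in $S^\infty\times\{0,\dots,M\}$ such that, for each $j=0,\dots,M$, $p_j=\mathbb P(Y=j)>0$ and, conditionally on $Y=j$, $X$ is a Poisson process on $S$ with $\nu$-integrable intensity $\lambda_j:S\to[0,\infty)$. Let $d$ be the distance on $S^\infty$ given by $$d(x,y)=\frac1{\mathrm{diam}(S)}d_H(x,y)+d_0(x,y),$$ where $d_H$ is the Hausdorff distance and $d_0:S^\infty\times S^\infty\to[0,1]$ satisfies, for all $x,y,z\in S^\infty$: (1) $\#x=\#y$ implies $d_0(x,y)=0$; (2) $d_0(x,y)=d_0(y,x)$; (3) $d_0(x,z)\le d_0(x,y)+d_0(y,z)$; (4) for every $x\in S^\infty$ there is $\epsilon_0(x)>0$ such that $d_0(x,y)<\epsilon_0(x)$ implies $\#x=\#y$. If every $\lambda_j$ is continuous on $S$ with respect to $\rho$, then the regression function $\eta(x)=\mathbb E(Y\mid X=x)$ is continuous with respect to $d$ (on the set where it is defined), and consequently it satisfies the Besicovitch condition $$\lim_{\epsilon\to0}P_X\Big\{x:\lim_{\delta\to0}\frac1{P_X(B_d(x,\delta))}\int_{B_d(x,\delta)}|\eta(x)-\eta(y)|\,dP_X(y)>\epsilon\Big\}=0.$$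
   Context: $S^\infty=\{x\subset S:\#x<\infty\}$ is the set of finite subsets of $S$, equipped with the $\sigma$-algebra generated by the counting maps $x\mapsto\#(x\cap A)$, $A\subset S$ Borel; $P_X$ is the distribution of $X$ on $S^\infty$. $\mathrm{diam}(S)=\sup_{x,y\in S}\rho(x,y)$. A random element $Z$ of $S^\infty$ is a Poisson process on $S$ with intensity $\lambda$ if, with $N_A=\#(Z\cap A)$: for disjoint Borel sets $A_1,\dots,A_n\subset S$ the variables $N_{A_1},\dots,N_{A_n}$ are independent, and $N_A$ is Poisson with mean $\mu(A)=\int_A\lambda\,d\nu$ for every Borel $A\subset S$. With $\mu_j(S)=\int_S\lambda_j\,d\nu$ and $f_{X_j}(x)=\exp[\nu(S)-\mu_j(S)]\prod_{\xi\in x}\lambda_j(\xi)$ (the density of the law of $X$ given $Y=j$ with respect to the Poisson process of intensity $1$), the regression function is the version $$\eta(x)=\frac{\sum_{j=0}^M j\,p_jf_{X_j}(x)}{\sum_{j=0}^Mp_jf_{X_j}(x)},$$ defined on the set (of full $P_X$-measure) where the denominator is positive. The Hausdorff distance is $d_H(A,C)=\max\{\sup_{a\in A}d(a,C),\sup_{c\in C}d(c,A)\}$ with $d(a,C)=\inf\{\rho(a,c):c\in C\}$; convention: $d_H(\emptyset,\emptyset)=0$, $d_H(\emptyset,x)=+\infty$ for $x\neq\emptyset$. $B_d(x,\delta)$ is the closed ball of centre $x$ and radius $\delta$ for $d$. *)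

(* Defs.v *)
From HB Require Import structures.
From mathcomp Require Import all_boot all_order all_algebra finmap.
From mathcomp Require Import all_classical all_reals all_analysis.

Set Implicit Arguments.
Unset Strict Implicit.
Unset Printing Implicit Defensive.

Import Order.TTheory GRing.Theory Num.Theory.
Import numFieldNormedType.Exports.

Local Open Scope classical_set_scope.
Local Open Scope ring_scope.

(* Measurable types of MathComp-Analysis are pointed, hence this join; a metric
   space of positive diameter is nonempty, so nothing is lost. *)
#[short(type="pmetricType")]
HB.structure Definition PMetric (K : numDomainType) :=
  { M of Metric K M & Pointed M }.

Section metric_space.
Context {R : realType}.

Definition separable_space (S : topologicalType) : Prop :=
  exists D : set S, countable D /\ dense D.

Definition distances (S : metricType R) : set R :=
  range (fun p : S * S => mdist p.1 p.2).

(* Meaningful only when [distances S] has an upper bound. *)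
Definition diam (S : metricType R) : R := sup (distances S).

Local Open Scope ereal_scope.

Definition dist_to_set (S : metricType R) (a : S) (C : {fset S}) : \bar R :=
  ereal_inf [set (mdist a c)%:E | c in [set` C]].

(* In [\bar R], [ereal_inf set0 = +oo] and [ereal_sup set0 = -oo]: the formula
   gives +oo when exactly one of the sets is empty, while it would give -oo on
   two empty sets, where the distance is 0 by convention. *)
Definition hausdorff_dist (S : metricType R) (A C : {fset S}) : \bar R :=
  if (A == fset0) && (C == fset0) then 0 else
  maxe (ereal_sup [set dist_to_set a C | a in [set` A]])
       (ereal_sup [set dist_to_set c A | c in [set` C]]).

End metric_space.

Notation borel S := (g_sigma_algebraType (@open S)).

Section configurations.
Context {R : realType} (S : pmetricType R).

Definition config : Type := {fset S}.
HB.instance Definition _ := Choice.on config.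
HB.instance Definition _ := isPointed.Build config (fset0 : {fset S}).

Definition count_in (A : set (borel S)) (x : config) : nat :=
  #|` [fset xi in (x : {fset S}) | xi \in (A : set S)]%fset|.

Definition counting_events : set (set config) :=
  [set E | exists2 A : set (borel S), measurable A &
           exists B : set nat, E = count_in A @^-1` B].

End configurations.

Notation config_space S := (g_sigma_algebraType (@counting_events _ S)).

Definition config_dist {R : realType} (S : pmetricType R)
    (d0 : {fset S} -> {fset S} -> R) (x y : config_space S) : \bar R :=
  (((diam S)^-1)%:E * hausdorff_dist x y + (d0 x y)%:E)%E.

Section poisson_process.
Context {R : realType} (d : measure_display) (Omega : measurableType d).
Implicit Type P : probability Omega R.

Definition independent_nat_rvs P (n : nat) (N : 'I_n -> Omega -> nat) : Prop :=
  forall B : 'I_n -> set nat,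
    P (\bigcap_i (N i @^-1` B i)) = (\prod_(i < n) P (N i @^-1` B i))%E.

(* When [0 < P E], this is [A |-> P (A `&` E) / P E]; the second argument of
   [mnormalize] is only used when [P E = 0]. *)
Definition cond_probability P (E : set Omega) (mE : measurable E)
  : probability Omega R := mnormalize (mrestr P mE) P.

(* [poisson_prob r k] does not depend on [k], and is the Dirac mass at 0 when
   [r = 0]. *)
Definition poisson_process (S : pmetricType R)
    (nu : {finite_measure set (borel S) -> \bar R}) (lambda : S -> R)
    P (Z : Omega -> config_space S) : Prop :=
  (forall (n : nat) (A : 'I_n -> set (borel S)),
      (forall i, measurable (A i)) -> trivIset setT A ->
      independent_nat_rvs P (fun i omega => count_in (A i) (Z omega))) /\
  (forall A : set (borel S), measurable A -> forall B : set nat,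
      P [set omega | B (count_in A (Z omega))] =
      poisson_prob (\int[nu]_(s in A) lambda s) 0%N B).

End poisson_process.

Section regression.
Context {R : realType} (S : pmetricType R).
Variables (nu : {finite_measure set (borel S) -> \bar R}) (M : nat).
Variables (p : 'I_M.+1 -> R) (lambda : 'I_M.+1 -> S -> R).

Definition class_density (j : 'I_M.+1) (x : config_space S) : R :=
  expR (fine (nu setT) - \int[nu]_(s in setT) lambda j s)
  * \prod_(xi <- (x : {fset S})) lambda j xi.

Definition mixture_density (x : config_space S) : R :=
  \sum_(j < M.+1) p j * class_density j x.

Definition regression_domain : set (config_space S) :=
  [set x | 0 < mixture_density x].

(* Takes the junk value 0 off [regression_domain], whose complement is null for
   the law of X. *)
Definition regression (x : config_space S) : R :=
  (\sum_(j < M.+1) j%:R * p j * class_density j x) / mixture_density x.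

End regression.

Section besicovitch.
Context {R : realType} (d : measure_display) (T : measurableType d).
Variables (PX : probability T R) (dist : T -> T -> \bar R).
Variables (D : set T) (eta : T -> R).

Definition continuous_on_wrt : Prop :=
  forall x, D x -> forall eps : R, 0 < eps ->
    exists2 delta : R, 0 < delta &
      forall y, D y -> (dist x y < delta%:E)%E -> `|eta y - eta x| < eps.

Definition closed_ball_wrt (x : T) (delta : R) : set T :=
  [set y | (dist x y <= delta%:E)%E].

Definition ball_average (x : T) (delta : R) : \bar R :=
  (((fine (PX (closed_ball_wrt x delta)))^-1)%:E *
   \int[PX]_(y in closed_ball_wrt x delta) (`|eta x - eta y|)%:E)%E.

(* The second clause excludes the quotients 0/0. *)
Definition has_average_limit (x : T) (l : \bar R) : Prop :=
  [/\ D x,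
      \forall delta \near 0^'+, (0 < PX (closed_ball_wrt x delta))%E &
      ball_average x delta @[delta --> 0^'+] --> l].

(* The limit is unique when it exists; the points where the limit is undefined
   vacuously belong to this set for every [eps]. *)
Definition besicovitch_bad_set (eps : R) : set T :=
  [set x | forall l, has_average_limit x l -> (eps%:E < l)%E].

(* The values of [PX] are meaningful on measurable sets only, hence the first
   clause. *)
Definition besicovitch_condition : Prop :=
  (forall eps : R, 0 < eps -> measurable (besicovitch_bad_set eps)) /\
  PX (besicovitch_bad_set eps) @[eps --> 0^'+] --> 0%E.

End besicovitch.

(* Main.v *)
Require Import Defs.
From HB Require Import structures.
From mathcomp Require Import all_boot all_order all_algebra finmap.
From mathcomp Require Import all_classical all_reals all_analysis.
From mathcomp Require Import measurable_realfun lra.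

Set Implicit Arguments.
Unset Strict Implicit.
Unset Printing Implicit Defensive.

Import Order.TTheory GRing.Theory Num.Theory.
Import numFieldNormedType.Exports.

Local Open Scope classical_set_scope.
Local Open Scope ring_scope.

(** If [y] is close to [x], then [#y = #x] by the separation property of [d0],
    and smallness of the Hausdorff distance matches the points of [y] with nearby
    points of [x]; hence the products of the [lambda j], and with them [eta], are
    continuous.

    Given [Y = j], the process has almost surely no point in [{lambda j = 0}], so
    [eta] is defined almost surely. The configurations form a second countable
    space, so the points having a null ball form a null set. At every other point
    of the domain the averages tend to 0 by continuity; hence the Besicovitch bad
    set does not depend on [eps] and is null. *)

(** Finiteness makes a pointwise strict bound uniform; the value [r + 1] serves the empty list. This
    is how positive radii are extracted from finite configurations below. *)
Lemma seq_lower_bound_gt (R : realType) (T : eqType) (s : seq T)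
    (f : T -> R) (r : R) :
  (forall c, c \in s -> r < f c) ->
  exists2 r' : R, r < r' & forall c, c \in s -> r' <= f c.
Proof.
elim: s => [|a s IHs] f_gt; first by exists (r + 1); rewrite ?ltrDl.
have [c cs|r' rr' f_ge] := IHs; first by apply: f_gt; rewrite inE cs orbT.
exists (Num.min r' (f a)); first by rewrite lt_min rr' f_gt ?mem_head.
move=> c; rewrite inE ge_min => /predU1P[->|/f_ge ->//].
by rewrite lexx orbT.
Qed.

(** * Hausdorff distance of finite sets *)

Section hausdorff.
Context {R : realType} (S : metricType R).
Implicit Types (x y : {fset S}) (a : S) (r : R).

(** An infimum over a nonempty finite set is attained, so even a non-strict bound has a witness; for
    empty [y] the infimum is [+oo] and both sides fail. *)
Lemma dist_to_set_le a y r :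
  (dist_to_set a y <= r%:E)%E <-> exists2 c, c \in y & mdist a c <= r.
Proof.
split=> [le_r|[c cy acr]]; last first.
  by apply: ge_ereal_inf; exists (mdist a c)%:E; [exists c|rewrite lee_fin].
apply: contrapT => no_c.
have [c cy|r' rr' r'_le] := @seq_lower_bound_gt R S y (mdist a) r.
  by rewrite ltNge; apply/negP => acr; apply: no_c; exists c.
move: rr'; rewrite ltNge -lee_fin => /negP; apply; apply: le_trans le_r.
by apply: le_ereal_inf_tmp => _ [c cy <-]; rewrite lee_fin r'_le.
Qed.

Definition hausdorff_close r x y : Prop :=
  (forall a, a \in x -> exists2 c, c \in y & mdist a c <= r) /\
  (forall c, c \in y -> exists2 a, a \in x & mdist a c <= r).

Lemma dist_to_set_ge0 a y : (0 <= dist_to_set a y)%E.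
Proof. by apply: le_ereal_inf_tmp => _ [c cy <-]; rewrite lee_fin mdist_ge0. Qed.

Lemma hausdorff_dist_ge0 x y : (0 <= hausdorff_dist x y)%E.
Proof.
rewrite /hausdorff_dist; case: ifPn => // /nandP[] /fset0Pn[a ain];
  rewrite le_max; apply/orP; [left|right];
  apply: (le_trans (dist_to_set_ge0 a _)); apply: ereal_sup_ubound;
  by exists a.
Qed.

(** The sign of [r] matters for two empty sets, which are at distance 0 but vacuously close for
    every [r]. *)
Lemma hausdorff_dist_le x y r : 0 <= r ->
  (hausdorff_dist x y <= r%:E)%E <-> hausdorff_close r x y.
Proof.
move=> r_ge0; rewrite /hausdorff_dist; case: ifPn => [/andP[/eqP -> /eqP ->]|_].
  by split=> // _; split.
rewrite ge_max; split=> [/andP[]|[xy yx]].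
  move=> /ereal_supP xy /ereal_supP yx; split=> [a ax|c cy].
    by apply/dist_to_set_le; apply: xy; exists a.
  have [|a ax ca] := (dist_to_set_le c x r).1; first by apply: yx; exists c.
  by exists a; rewrite // metric_sym.
apply/andP; split; apply: ge_ereal_sup => _ [a /= ain <-]; apply/dist_to_set_le.
  exact: xy.
by have [c cin ca] := yx _ ain; exists c; rewrite // metric_sym.
Qed.

End hausdorff.

(** * Measurability of events on configurations *)

Section counting_measurability.
Context {R : realType} (S : pmetricType R).
Implicit Types (x y : {fset S}) (A : set (borel S)).

Lemma count_in_gt0 A x : (0 < count_in A x)%N <-> exists2 c, c \in x & A c.
Proof.
rewrite /count_in cardfs_gt0; split=> [/fset0Pn[c]|[c cx Ac]].
  by rewrite !inE => /andP[cx /set_mem Ac]; exists c.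
by apply/fset0Pn; exists c; rewrite !inE cx; exact/mem_set.
Qed.

Lemma count_in_eq0 A x : count_in A x = 0%N <-> forall c, c \in x -> ~ A c.
Proof.
split=> [A0 c cx Ac|xNA].
  by have /count_in_gt0 : exists2 c, c \in x & A c; [exists c|rewrite A0].
apply/eqP; rewrite -leqn0 leqNgt; apply/negP => /count_in_gt0[c cx].
exact: xNA.
Qed.

Lemma count_in_setT x : count_in setT x = #|` x|.
Proof.
rewrite /count_in; congr #|` _|; apply/fsetP => c.
by rewrite !inE; case: (c \in x) => //=; exact/mem_set.
Qed.

Lemma measurable_count_in A (B : set nat) : measurable A ->
  measurable ([set x | B (count_in A x)] : set (config_space S)).
Proof. by move=> mA; apply: sub_sigma_algebra; exists A => //; exists B. Qed.

Lemma measurable_card (n : nat) :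
  measurable ([set x | #|` x| = n] : set (config_space S)).
Proof.
rewrite [X in measurable X](_ : _ =
    [set x : config_space S | [set n] (count_in setT x)]).
  exact: measurable_count_in.
by apply/seteqP; split=> x /=; rewrite count_in_setT.
Qed.

Lemma measurable_meets A : measurable A ->
  measurable ([set x | exists2 c, c \in (x : {fset S}) & A c]
    : set (config_space S)).
Proof.
move=> mA; rewrite [X in measurable X](_ : _ =
    [set x : config_space S | [set n | (0 < n)%N] (count_in A x)]).
  exact: measurable_count_in.
by apply/seteqP; split=> x /= /count_in_gt0.
Qed.

Lemma measurable_within A : measurable A ->
  measurable ([set x | forall c, c \in (x : {fset S}) -> A c]
    : set (config_space S)).
Proof.
move=> mA; rewrite [X in measurable X](_ : _ =
    [set x : config_space S | [set 0%N] (count_in (~` A) x)]).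
  by apply: measurable_count_in; exact: measurableC.
apply/seteqP; split=> x /= => [xA|/count_in_eq0 + c cx].
  by apply/count_in_eq0 => c cx; apply; exact: xA.
by move=> /(_ c cx)/contrapT.
Qed.

Lemma measurable_open_borel A : open (A : set S) -> measurable A.
Proof. exact: sub_sigma_algebra. Qed.

Lemma measurable_ball (a : S) (r : R) : measurable (ball a r : set (borel S)).
Proof.
apply: measurable_open_borel; rewrite openE => c.
rewrite ballEmdist /= => ac; rewrite /interior.
apply/nbhs_ballP; exists (r - mdist a c); first by rewrite /= subr_gt0.
by move=> b; rewrite !ballEmdist /=; have := metric_triangle a c b; lra.
Qed.

Lemma measurable_closed_ball (a : S) (r : R) :
  measurable ([set c | mdist a c <= r] : set (borel S)).
Proof.
rewrite -[X in measurable X]setCK; apply: measurableC.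
apply: measurable_open_borel; rewrite openE => c /= /negP.
rewrite -ltNge => rac; rewrite /interior.
apply/nbhs_ballP; exists (mdist a c - r); first by rewrite /= subr_gt0.
move=> b; rewrite ballEmdist /= => cb; apply/negP; rewrite -ltNge.
have := metric_triangle a b c; rewrite (metric_sym b c); lra.
Qed.

(** Closeness to a finite [x] amounts to one hitting condition per point of [x] and a single
    containment condition, each of them a counting event. *)
Lemma measurable_hausdorff_close (r : R) x :
  measurable ([set y | hausdorff_close r x y] : set (config_space S)).
Proof.
pose B a : set (borel S) := [set c | mdist a c <= r].
rewrite [X in measurable X](_ : _ =
    (\bigcap_(a in [set` x]) [set y | exists2 c, c \in (y : {fset S}) & B a c])
    `&` [set y | forall c, c \in (y : {fset S}) ->
                 (\bigcup_(a in [set` x]) B a) c]).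
  apply: measurableI.
    apply: fin_bigcap_measurable => // a _; apply: measurable_meets.
    exact: measurable_closed_ball.
  apply: measurable_within; apply: fin_bigcup_measurable => // a _.
  exact: measurable_closed_ball.
by apply/seteqP; split=> y [xy yx]; split=> // c /yx[a ax ac]; exists a.
Qed.

End counting_measurability.

(** * The distance on configurations and its closed balls *)

Section config_distance.
Context {R : realType} (S : pmetricType R).
Hypothesis diam_gt0 : 0 < diam S.
Variable d0 : {fset S} -> {fset S} -> R.
Hypothesis d0_range : forall x y, 0 <= d0 x y <= 1.
Hypothesis d0_card : forall x y : {fset S}, #|` x| = #|` y| -> d0 x y = 0.
Hypothesis d0_triangle : forall x y z, d0 x z <= d0 x y + d0 y z.
Hypothesis d0_sep : forall x : {fset S}, exists2 eps0 : R, 0 < eps0 &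
  forall y : {fset S}, d0 x y < eps0 -> #|` x| = #|` y|.
Implicit Types x y : {fset S}.

(** The inequality is solved for the Hausdorff distance, whose nonnegativity forces
    [d0 x y <= r]. *)
Lemma config_dist_le x y r : (config_dist d0 x y <= r%:E)%E <->
  d0 x y <= r /\ hausdorff_close (diam S * (r - d0 x y)) x y.
Proof.
rewrite /config_dist -leeBrDr// muleC lee_pdivrMr// -EFinB -EFinM mulrC.
have [d0_le|d0_gt] := leP (d0 x y) r.
  rewrite hausdorff_dist_le; first by split=> [|[]].
  by rewrite mulr_ge0 ?subr_ge0// ltW.
split=> [|[]//].
move/(le_trans (hausdorff_dist_ge0 x y)); rewrite lee_fin.
by rewrite pmulr_rge0// subr_ge0 leNgt d0_gt.
Qed.

Lemma hausdorff_close_le r r' x y : r <= r' ->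
  hausdorff_close r x y -> hausdorff_close r' x y.
Proof.
move=> rr' [xy yx]; split=> [a /xy[c cy ac]|c /yx[a ax ac]].
  by exists c; rewrite // (le_trans ac).
by exists a; rewrite // (le_trans ac).
Qed.

Lemma config_dist_near x r : 0 < r -> exists2 delta : R, 0 < delta &
  forall y, (config_dist d0 x y <= delta%:E)%E ->
    #|` x| = #|` y| /\ hausdorff_close r x y.
Proof.
move=> r_gt0; have [eps0 eps0_gt0 eps0P] := d0_sep x.
(* The half makes the bound on [d0] strict, as [d0_sep] requires; dividing by [diam S] undoes the
   normalisation of the Hausdorff distance. *)
exists (Num.min (eps0 / 2) (r / diam S)).
  by rewrite lt_min !divr_gt0.
move=> y /config_dist_le[]; rewrite le_min => /andP[d0_le _] xy; split.
  by apply: eps0P; lra.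
apply: hausdorff_close_le xy; rewrite mulrC -ler_pdivlMr//.
have /andP[d0_ge0 _] := d0_range x y.
by rewrite lerBlDr (le_trans (_ : _ <= r / diam S)) ?ge_min ?lexx ?orbT ?lerDl.
Qed.

Lemma config_dist_le_of_close x y r : 0 <= r -> #|` x| = #|` y| ->
  hausdorff_close (diam S * r) x y -> (config_dist d0 x y <= r%:E)%E.
Proof.
by move=> r_ge0 xy cl; apply/config_dist_le; rewrite d0_card// subr0.
Qed.

(** The triangle inequality is applied both ways, the term between [y] and [z] being 0. Thus [d0 x]
    sees only the number of points of its argument. *)
Lemma d0_card_congr x y z : #|` y| = #|` z| -> d0 x y = d0 x z.
Proof.
move=> yz; apply/eqP; rewrite eq_le.
have := d0_triangle x y z; have := d0_triangle x z y.
by rewrite (d0_card yz) (d0_card (esym yz)) !addr0 => -> ->.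
Qed.

(** On each slice of configurations with [n] points [d0 x] is constant, so the ball is there either
    empty or a closeness event. *)
Lemma measurable_config_ball x r :
  measurable (closed_ball_wrt (config_dist d0) (x : config_space S) r).
Proof.
pose B n := closed_ball_wrt (config_dist d0) (x : config_space S) r
  `&` [set y : config_space S | #|` y| = n].
rewrite [X in measurable X](_ : _ = \bigcup_n B n); last first.
  by apply/seteqP; split=> [y xy|y [n _ []]//]; exists #|` y|.
apply: bigcupT_measurable => n.
(* [z] represents the slice and names the constant value [d0 x z]; the slice is empty if [S] has
   fewer than [n] points. *)
have [[z zn]|no_z] := pselect (exists z : {fset S}, #|` z| = n); last first.
  rewrite [B n](_ : _ = set0)//; apply/seteqP; split=> // y [_ yn].
  by apply: no_z; exists y.
have [d0_le|d0_gt] := leP (d0 x z) r; last first.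
  rewrite [B n](_ : _ = set0)//; apply/seteqP; split=> // y [/config_dist_le[]].
  move=> + _ yn; rewrite (@d0_card_congr _ _ z); last by rewrite yn.
  by rewrite leNgt d0_gt.
rewrite [B n](_ : _ = [set y | hausdorff_close (diam S * (r - d0 x z)) x y]
  `&` [set y : config_space S | #|` y| = n]).
  by apply: measurableI; [exact: measurable_hausdorff_close|exact: measurable_card].
apply/seteqP; split=> y [xy yn]; split=> //; move: xy.
  by move=> /config_dist_le[_]; rewrite (@d0_card_congr _ _ z)// yn.
by move=> xy; apply/config_dist_le; rewrite (@d0_card_congr _ y z)// yn.
Qed.

End config_distance.

(** * Second countability and the points having a null ball *)

Lemma separable_dense_seq (R : realType) (S : pmetricType R) :
  separable_space S ->
  exists q : nat -> S, forall (a : S) (r : R), 0 < r -> exists i, ball (q i) r a.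
Proof.
move=> [D [/pfcard_geP[D0|[q]] D_dense]].
  have [] := D_dense setT; [by exists point|exact: openT|].
  by move=> a []; rewrite D0.
exists q => a r r_gt0.
have [] := D_dense (ball a r)°; [|exact: open_interior|].
  by exists a; apply: nbhsx_ballx.
move=> b [/interior_subset ab /(@surj _ _ _ _ q)[i _ qi]].
by exists i; rewrite qi; apply: ball_sym.
Qed.

Section null_balls.
Context {R : realType} (S : pmetricType R).
Hypothesis sepS : separable_space S.
Hypothesis diam_gt0 : 0 < diam S.
Variable d0 : {fset S} -> {fset S} -> R.
Hypothesis d0_range : forall x y, 0 <= d0 x y <= 1.
Hypothesis d0_card : forall x y : {fset S}, #|` x| = #|` y| -> d0 x y = 0.
Hypothesis d0_triangle : forall x y z, d0 x z <= d0 x y + d0 y z.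
Hypothesis d0_sep : forall x : {fset S}, exists2 eps0 : R, 0 < eps0 &
  forall y : {fset S}, d0 x y < eps0 -> #|` x| = #|` y|.
Variable mu : {measure set (config_space S) -> \bar R}.

Variable q : nat -> S.

Definition small_ball (ik : nat * nat) : set S := ball (q ik.1) ik.2.+1%:R^-1.

(* A countable base for [config_dist d0]; working with it rather than with balls
   around a dense family avoids the triangle inequality for the Hausdorff
   distance. *)
Definition basic_nbhd (u : nat * seq (nat * nat)) : set (config_space S) :=
  [set x | #|` x| = u.1] `&`
  \bigcap_(ik in [set` u.2])
    [set x | exists2 c, c \in (x : {fset S}) & small_ball ik c] `&`
  [set x | forall c, c \in (x : {fset S}) ->
     (\bigcup_(ik in [set` u.2]) small_ball ik) c].

Lemma measurable_basic_nbhd u : measurable (basic_nbhd u).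
Proof.
have m_ball ik : measurable (small_ball ik : set (borel S)).
  exact: measurable_ball.
apply: measurableI; first apply: measurableI; first exact: measurable_card.
  by apply: fin_bigcap_measurable => // ik _; apply: measurable_meets.
by apply: measurable_within; apply: fin_bigcup_measurable.
Qed.

(** Membership rests on the number of points and on finitely many strict inequalities, which survive
    small displacements. *)
Lemma basic_nbhd_open u (x : config_space S) : basic_nbhd u x ->
  exists2 r : R, 0 < r & closed_ball_wrt (config_dist d0) x r `<=` basic_nbhd u.
Proof.
move=> [[/= xn x_meets] x_within].
(* The room left between a point and the boundary of a small ball containing it; the other pairs get
   the harmless value 1. *)
pose slack (t : S * (nat * nat)) : R :=
  if `[< small_ball t.2 t.1 >] then t.2.2.+1%:R^-1 - mdist (q t.2.1) t.1 else 1.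
have [t _|r r_gt0 r_le] := @seq_lower_bound_gt R _
    [seq (a, ik) | a <- (x : {fset S}), ik <- u.2] slack 0.
  rewrite /slack; case: asboolP => //.
  by rewrite /small_ball ballEmdist /= subr_gt0.
(* A move by at most half of the common slack keeps the inequality strict. *)
have stays a b ik : a \in (x : {fset S}) -> ik \in u.2 -> small_ball ik a ->
    mdist a b <= r / 2 -> small_ball ik b.
  move=> ax iku ika ab; have := r_le (a, ik).
  rewrite allpairs_f// /slack asboolT//= => /(_ isT).
  rewrite /small_ball ballEmdist /=.
  by move: (_^-1) (metric_triangle (q ik.1) a b) => e; lra.
have r2_gt0 : 0 < r / 2 by rewrite divr_gt0.
have [delta delta_gt0 near_x] := config_dist_near diam_gt0 d0_range d0_sep x r2_gt0.
exists delta => // y /near_x[xy [x_to_y y_to_x]]; split; first split.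
- by rewrite /= -xy.
- move=> ik iku; have [a ax ika] := x_meets ik iku.
  have [c cy ac] := x_to_y _ ax; exists c => //.
  exact: (stays a).
- move=> c cy; have [a ax ac] := y_to_x _ cy.
  have [ik iku ika] := x_within _ ax; exists ik => //.
  exact: (stays a).
Qed.

Hypothesis q_dense : forall (a : S) (r : R), 0 < r -> exists i, ball (q i) r a.

Lemma basic_nbhd_base (x : config_space S) r : 0 < r ->
  exists2 u, basic_nbhd u x &
    basic_nbhd u `<=` closed_ball_wrt (config_dist d0) x r.
Proof.
move=> r_gt0; have dr_gt0 : 0 < diam S * r / 2 by rewrite divr_gt0// mulr_gt0.
(* With radius below half of [diam S * r], any two points of one small ball are within [diam S * r]
   of each other. *)
pose k := Num.truncn (diam S * r / 2)^-1.
have k_lt : k.+1%:R^-1 < diam S * r / 2.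
  rewrite invf_plt ?posrE//; exact: truncnS_gt.
have k_gt0 : 0 < k.+1%:R^-1 :> R by rewrite invr_gt0.
have [i iP] := choice (fun a => q_dense a k_gt0).
have same_ball a b c : ball (q (i a)) k.+1%:R^-1 b ->
    ball (q (i a)) k.+1%:R^-1 c -> mdist b c <= diam S * r.
  rewrite !ballEmdist /=.
  move: (_^-1) k_lt (metric_triangle b (q (i a)) c) => e.
  by rewrite (metric_sym b (q _)); lra.
exists (#|` x|, [seq (i a, k) | a <- (x : {fset S})]).
  split; first split=> //.
    by move=> ik /mapP[a ax ->]; exists a => //; exact: iP.
  by move=> c cx; exists (i c, k); [apply/mapP; exists c|exact: iP].
move=> y [[/= yx y_meets] y_within].
apply: config_dist_le_of_close => //; first exact: ltW.
split=> [a ax|c cy].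
  have [|c cy ac] := y_meets (i a, k); first by apply/mapP; exists a.
  by exists c => //; apply: same_ball (iP a) ac.
have [_ /mapP[a ax ->] ac] := y_within _ cy.
by exists a => //; apply: same_ball (iP a) ac.
Qed.

(** A null ball contains a null basic neighbourhood of its centre, and a null basic neighbourhood
    contains a ball around each of its points. An uncountable union thus becomes a countable one. *)
Lemma null_ball_basic :
  [set x | ~ forall r : R, 0 < r ->
      (0 < mu (closed_ball_wrt (config_dist d0) x r))%E] =
  \bigcup_(u in [set u | mu (basic_nbhd u) = 0%E]) basic_nbhd u.
Proof.
apply/seteqP; split=> x /=.
  move=> /existsNP[r /not_implyP[r_gt0 /negP]]; rewrite -leNgt measure_le0.
  move=> /eqP ball0; have [u ux u_sub] := basic_nbhd_base x r_gt0.
  exists u => //=; apply: (subset_measure0 _ _ u_sub) => //.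
    exact: measurable_basic_nbhd.
  exact: measurable_config_ball.
move=> [u /= u0 /basic_nbhd_open[r r_gt0 ball_sub]] /(_ r r_gt0).
rewrite lt_neqAle eq_sym => /andP[/eqP + _]; apply.
apply: (subset_measure0 _ _ ball_sub) => //; last exact: measurable_basic_nbhd.
exact: measurable_config_ball.
Qed.

End null_balls.

Lemma countable_bigcup_null (T : countType) (d : measure_display) (U : measurableType d)
    (R : realType) (mu : {measure set U -> \bar R}) (F : T -> set U) :
  (forall u, measurable (F u)) ->
  let N := \bigcup_(u in [set u | mu (F u) = 0%E]) F u in
  measurable N /\ mu N = 0%E.
Proof.
move=> mF N.
(* [G] runs over the codes of [T], with the empty set at codes that stand for nothing or for a set
   that is not null. *)
pose G n := if choice.unpickle n is Some u then
  if mu (F u) == 0%E then F u else set0 else set0.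
have mG n : measurable (G n).
  by rewrite /G; case: choice.unpickle => // u; case: ifP.
have G0 n : mu (G n) = 0%E.
  by rewrite /G; case: choice.unpickle => [u|]; rewrite ?measure0//; case: eqP.
have NE : N = \bigcup_n G n.
  apply/seteqP; split=> [x [u /= u0 Fx]|x [n _]].
    by exists (choice.pickle u) => //; rewrite /G choice.pickleK u0 eqxx.
  by rewrite /G; case: choice.unpickle => // u; case: eqP => // u0 Fx; exists u.
have mN : measurable N by rewrite NE; exact: bigcupT_measurable.
split=> //; apply: measure_negligible => //; rewrite NE.
apply: negligible_bigcup => n; exists (G n); split => //.
Qed.

(** * Continuity of the regression function *)

Section regression_continuity.
Context {R : realType} (S : pmetricType R).

Definition displacement_le (r : R) : set (S -> S) :=
  [set g | forall a, mdist a (g a) <= r].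

(** Configurations near [x] will be images of [x] under maps tending to the identity, so that a
    product over a varying set becomes one over the fixed list [x]. *)
Definition near_identity : set_system (S -> S) :=
  filter_from [set r : R | 0 < r] displacement_le.

#[local] Instance near_identity_filter : Filter near_identity.
Proof.
apply: filter_from_filter; first by exists 1 => /=.
move=> r s r_gt0 s_gt0; exists (Num.min r s); first by rewrite /= lt_min r_gt0.
by move=> g g_le; split=> a; have := g_le a; rewrite le_min => /andP[].
Qed.

(** Along [near_identity] each [g a] tends to [a], so every factor converges by continuity of
    [f]. *)
Lemma cvg_prod_displaced (f : S -> R) (s : seq S) : continuous f ->
  \prod_(a <- s) f (g a) @[g --> near_identity] --> \prod_(a <- s) f a.
Proof.
move=> f_cont; apply: cvg_big => [|a _]; first exact: mul_continuous.
apply: (@cvg_comp _ _ _ (fun g : S -> S => g a) f _ (nbhs a)); last exact: f_cont.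
move=> A /nbhs_ballP[r /= r_gt0 sub_A].
exists (r / 2); first by rewrite /= divr_gt0.
by move=> g /(_ a) ag; apply: sub_A; rewrite ballEmdist /=; lra.
Qed.

Lemma separation (x : {fset S}) : exists2 r : R, 0 < r &
  forall a b, a \in x -> b \in x -> mdist a b < r -> a = b.
Proof.
(* The value 1 on the diagonal keeps [f] positive on all pairs. *)
pose f (ab : S * S) : R := if ab.1 == ab.2 then 1 else mdist ab.1 ab.2.
have [ab _|r r_gt0 r_le] := @seq_lower_bound_gt R _
    [seq (a, b) | a <- x, b <- x] f 0.
  by rewrite /f; case: ifPn => // ab_neq; rewrite mdist_gt0.
exists r => // a b ax bx; have := r_le (a, b).
rewrite allpairs_f// /f /= => /(_ isT); case: eqP => // _.
by move=> /le_lt_trans/[apply]; rewrite ltxx.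
Qed.

(* At distances below half the separation of the points of [x], choosing a close
   point of [y] for each point of [x] is injective, hence bijective as both sets
   have the same number of points. *)
Lemma hausdorff_close_matching (x : {fset S}) : exists2 r0 : R, 0 < r0 &
  forall r y, 0 <= r -> r < r0 -> #|` x| = #|` y| -> hausdorff_close r x y ->
    exists2 g, displacement_le r g &
      forall f : S -> R, \prod_(b <- y) f b = \prod_(a <- x) f (g a).
Proof.
have [r0 r0_gt0 sep] := separation x.
exists (r0 / 2); first by rewrite divr_gt0.
move=> r y r_ge0 r_lt xy [x_to_y _].
(* The displacement bound concerns all of [S], so [g] is the identity off [x]. *)
have [|g gP] := @choice _ _ (fun a c => mdist a c <= r /\ (a \in x -> c \in y)).
  move=> a; have [ax|aNx] := boolP (a \in x).
    by have [c cy ac] := x_to_y a ax; exists c.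
  by exists a; rewrite mdistxx.
have g_inj : {in x &, injective g}.
  move=> a b ax bx gab; apply: sep => //.
  have [ag _] := gP a; have [bg _] := gP b.
  have := metric_triangle a (g a) b; rewrite {2}gab (metric_sym (g b)); lra.
exists g => [a|f]; first by have [] := gP a.
have <- : (g @` x)%fset = y.
  have card_gx : #|` (g @` x)%fset| = #|` x| by exact: card_in_imfset.
  apply/eqP; rewrite eqEfcard card_gx xy leqnn andbT.
  by apply/fsubsetP => _ /imfsetP[a /= ax ->]; have [_] := gP a; apply.
exact: big_imfset.
Qed.

Hypothesis diam_gt0 : 0 < diam S.
Variable d0 : {fset S} -> {fset S} -> R.
Hypothesis d0_range : forall x y, 0 <= d0 x y <= 1.
Hypothesis d0_sep : forall x : {fset S}, exists2 eps0 : R, 0 < eps0 &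
  forall y : {fset S}, d0 x y < eps0 -> #|` x| = #|` y|.

Definition config_nbhs (x : config_space S) : set_system (config_space S) :=
  filter_from [set r : R | 0 < r]
    (fun r => [set y | (config_dist d0 x y < r%:E)%E]).

#[local] Instance config_nbhs_filter x : Filter (config_nbhs x).
Proof.
apply: filter_from_filter; first by exists 1 => /=.
move=> r s r_gt0 s_gt0; exists (Num.min r s); first by rewrite /= lt_min r_gt0.
move=> y /= xy; split; apply: (lt_le_trans xy);
  by rewrite lee_fin ge_min lexx ?orbT.
Qed.

Lemma cvg_prod_config (f : S -> R) (x : config_space S) : continuous f ->
  \prod_(b <- (y : {fset S})) f b @[y --> config_nbhs x] -->
  \prod_(a <- (x : {fset S})) f a.
Proof.
move=> f_cont A /(cvg_prod_displaced (s := x) f_cont)[r /= r_gt0 sub_A].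
have [r0 r0_gt0 matching] := hausdorff_close_matching x.
(* [r0 / 2] meets the strict bound of the matching, and [r] is the displacement allowed by
   [sub_A]. *)
pose r1 := Num.min (r0 / 2) r.
have r1_gt0 : 0 < r1 by rewrite lt_min r_gt0 divr_gt0.
have [delta delta_gt0 near_x] := config_dist_near diam_gt0 d0_range d0_sep x r1_gt0.
exists delta => // y /= /ltW/near_x[xy x_close_y].
have r1_lt : r1 < r0 by rewrite gt_min; apply/orP; left; lra.
have [g g_le ->] := matching r1 y (ltW r1_gt0) r1_lt xy x_close_y.
by apply: sub_A => a; rewrite (le_trans (g_le a))// ge_min lexx orbT.
Qed.

Variables (nu : {finite_measure set (borel S) -> \bar R}) (M : nat).
Variables (p : 'I_M.+1 -> R) (lambda : 'I_M.+1 -> S -> R).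
Hypothesis lambda_cont : forall j, continuous (lambda j).

Lemma cvg_class_density j x :
  class_density nu lambda j y @[y --> config_nbhs x] -->
  class_density nu lambda j x.
Proof. by apply: cvgM; [exact: cvg_cst|exact: cvg_prod_config]. Qed.

Lemma cvg_regression x : regression_domain nu p lambda x ->
  regression nu p lambda y @[y --> config_nbhs x] --> regression nu p lambda x.
Proof.
move=> Dx; apply: cvgM.
  apply: cvg_big => [|j _]; first exact: add_continuous.
  by apply: cvgM; [exact: cvg_cst|exact: cvg_class_density].
apply: cvgV; first by rewrite gt_eqF.
apply: cvg_big => [|j _]; first exact: add_continuous.
by apply: cvgM; [exact: cvg_cst|exact: cvg_class_density].
Qed.

Lemma regression_continuous :
  continuous_on_wrt (config_dist d0) (regression_domain nu p lambda)
    (regression nu p lambda).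
Proof.
move=> x Dx eps eps_gt0.
have /cvgrPdist_lt/(_ eps eps_gt0)[delta delta_gt0 near_x] := cvg_regression Dx.
by exists delta => // y _ /near_x /=; rewrite distrC.
Qed.

End regression_continuity.

(** * Full measure of the domain of the regression function *)

Lemma cond_probability_eq0 (R : realType) (d : measure_display)
    (Omega : measurableType d) (P : probability Omega R) (E : set Omega)
    (mE : measurable E) (U : set Omega) :
  (0 < P E)%E -> cond_probability P mE U = 0%E -> P (U `&` E) = 0%E.
Proof.
move=> PE_gt0; rewrite /cond_probability /= /mnormalize /= /mrestr setTI.
have PE_fin : P E \is a fin_num by exact: fin_num_measure.
(* [P E] is neither 0 nor [+oo], so [mnormalize] is the quotient and not its default. *)
rewrite gt_eqF//= lt_eqF; last by rewrite ltey_eq PE_fin.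
move=> /eqP; rewrite mule_eq0 => /orP[/eqP //|].
by rewrite eqe invr_eq0 fine_eq0// gt_eqF.
Qed.

Section regression_domain_full.
Context {R : realType} (S : pmetricType R).
Variables (nu : {finite_measure set (borel S) -> \bar R}).
Variables (M : nat) (p : 'I_M.+1 -> R) (lambda : 'I_M.+1 -> S -> R).
Hypothesis p_gt0 : forall j, 0 < p j.
Hypothesis lambda_ge0 : forall j s, 0 <= lambda j s.
Hypothesis lambda_cont : forall j, continuous (lambda j).

Definition zero_set (j : 'I_M.+1) : set (borel S) := [set s | lambda j s = 0].

Lemma measurable_zero_set j : measurable (zero_set j).
Proof.
rewrite -[zero_set j]setCK; apply: measurableC; apply: measurable_open_borel.
rewrite [X in open X](_ : _ = (lambda j : S -> R) @^-1` [set r | r != 0]).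
  by apply: open_comp => [s _|]; [exact: lambda_cont|exact: open_neq].
by apply/seteqP; split=> s /eqP.
Qed.

(** A sum of nonnegative terms is positive iff one of them is. The weights and exponentials are
    positive, and the product for [j] vanishes exactly when [x] meets the zero set of [lambda j]. *)
Lemma regression_domainE : regression_domain nu p lambda =
  \bigcup_j [set x | [set 0%N] (count_in (zero_set j) x)].
Proof.
have class_ge0 j x : 0 <= class_density nu lambda j x.
  by rewrite mulr_ge0 ?expR_ge0// prodr_ge0.
apply/seteqP; split=> x.
  rewrite /regression_domain /= lt_neqAle eq_sym => /andP[mix_neq0 _].
  apply: contrapT => no_j; move/eqP: mix_neq0; apply.
  rewrite /mixture_density big1// => j _; rewrite /class_density.
  have [a ax la0] : exists2 a, a \in (x : {fset S}) & zero_set j a.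
    by apply/count_in_gt0; rewrite lt0n; apply/eqP => c0; apply: no_j; exists j.
  by rewrite (big_fsetD1 a ax)/= la0 mul0r !mulr0.
move=> [j _ /count_in_eq0 lambda_neq0].
rewrite /regression_domain /= /mixture_density (bigD1 j)//=.
rewrite ltr_wpDr//; first by apply: sumr_ge0 => i _; rewrite mulr_ge0// ltW.
rewrite mulr_gt0// mulr_gt0 ?expR_gt0// big_seq prodr_gt0// => a ax.
by rewrite lt_neqAle lambda_ge0 andbT eq_sym; apply/eqP; exact: lambda_neq0.
Qed.

Lemma measurable_regression_domain :
  measurable (regression_domain nu p lambda : set (config_space S)).
Proof.
rewrite regression_domainE; apply: fin_bigcup_measurable => // j _.
by apply: measurable_count_in; exact: measurable_zero_set.
Qed.

(** Off the domain, [X] meets every zero set, in particular that of its own class [j]; given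
    [Y = j], the number of points there is Poisson with mean 0. *)
Lemma regression_domain_full (d : measure_display) (Omega : measurableType d)
    (P : probability Omega R) (X : {RV P >-> config_space S})
    (Y : Omega -> 'I_M.+1) (mY : forall j, measurable (Y @^-1` [set j])) :
  (forall j, P (Y @^-1` [set j]) = (p j)%:E) ->
  (forall j, poisson_process nu (lambda j) (cond_probability P (mY j)) X) ->
  distribution P X (~` regression_domain nu p lambda) = 0%E.
Proof.
move=> pE XY.
have mX U : measurable U -> measurable (X @^-1` U).
  by move=> mU; rewrite -[X in measurable X]setTI; exact: measurable_funP.
apply: (@measure_negligible _ _ _ P).
  by apply: mX; apply: measurableC; exact: measurable_regression_domain.
pose B j := X @^-1` (~` regression_domain nu p lambda) `&` Y @^-1` [set j].
(* [inord] indexes the classes by [nat], repeating class 0 beyond [M], so that countable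
   subadditivity applies. *)
apply: (@negligibleS _ _ _ _ (\bigcup_k B (inord k))).
  by move=> w Xw; exists (Y w : nat) => //; rewrite inord_val.
apply: negligible_bigcup => k; move: (inord k) => j.
pose Z := X @^-1` [set x | [set~ 0%N] (count_in (zero_set j) x)].
exists (Z `&` Y @^-1` [set j]); split.
- apply: measurableI => //.
  by apply: mX; apply: measurable_count_in; exact: measurable_zero_set.
- apply: cond_probability_eq0; first by rewrite pE lte_fin.
  rewrite [LHS](XY j).2; last exact: measurable_zero_set.
  have -> : \int[nu]_(s in zero_set j) lambda j s = 0.
    rewrite /Rintegral integral0_eq// => s.
    by rewrite /zero_set /= => ->.
  (* At mean 0 the law is the Dirac mass at 0, which does not charge the nonzero counts. *)
  by rewrite /poisson_prob ltxx diracE memNset//=; apply.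
- move=> w [XND Yw]; split=> // count0; apply: XND.
  by rewrite regression_domainE; exists j.
Qed.

End regression_domain_full.

(** The integral of a nonnegative function, measurable or not, is the supremum of the integrals of
    the simple functions below it. *)
Lemma le_integral_nonmeasurable d (T : measurableType d) (R : realType)
    (mu : {measure set T -> \bar R}) (D : set T) (f1 f2 : T -> \bar R) :
  (forall x, D x -> 0 <= f1 x)%E -> (forall x, D x -> f1 x <= f2 x)%E ->
  (\int[mu]_(x in D) f1 x <= \int[mu]_(x in D) f2 x)%E.
Proof.
move=> f1_ge0 f12; rewrite !(integral_mkcond D) !ge0_integralTE.
- apply: ereal_sup_le => _ [h /= h_le <-]; exists h => // x.
  by apply: le_trans (h_le x) _; exact: lee_restrict.
- by apply: erestrict_ge0 => x Dx; rewrite (le_trans _ (f12 x Dx)) ?f1_ge0.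
- exact: erestrict_ge0.
Qed.

(** * From continuity to the Besicovitch condition *)

Section besicovitch_of_continuity.
Context {R : realType} (d : measure_display) (T : measurableType d).
Variables (PX : probability T R) (dist : T -> T -> \bar R).
Variables (D : set T) (eta : T -> R).

Definition ball_support : set T :=
  [set x | forall r : R, 0 < r -> (0 < PX (closed_ball_wrt dist x r))%E].

Hypothesis mball : forall x r, measurable (closed_ball_wrt dist x r).
Hypothesis mD : measurable D.
Hypothesis PXD : PX (~` D) = 0%E.
Hypothesis msupp : measurable ball_support.
Hypothesis PXsupp : PX (~` ball_support) = 0%E.
Hypothesis eta_cont : continuous_on_wrt dist D eta.

(** Continuity bounds the integrand by [eps] on the part of the ball inside [D]; the rest of the
    ball is null. *)
Lemma ball_average_le x eps : D x -> 0 < eps ->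
  exists2 r0 : R, 0 < r0 & forall r, 0 < r -> r < r0 ->
    (0 < PX (closed_ball_wrt dist x r))%E ->
    (0 <= ball_average PX dist eta x r <= eps%:E)%E.
Proof.
move=> Dx eps_gt0; have [r0 r0_gt0 near_x] := eta_cont Dx eps_gt0.
exists r0 => // r r_gt0 r_lt ball_gt0.
set B := closed_ball_wrt dist x r in ball_gt0 *.
have mB : measurable B by exact: mball.
have PB_fin : PX B \is a fin_num by exact: fin_num_measure.
have fine_gt0 : 0 < fine (PX B) by rewrite fine_gt0// ball_gt0 ltey_eq PB_fin.
have int_le : (\int[PX]_(y in B) (`|eta x - eta y|)%:E <= eps%:E * PX B)%E.
  (* [eta] need not be measurable; [g] is, and equals [eps] almost surely. *)
  pose g (y : T) : \bar R := if y \in D then eps%:E else +oo%E.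
  have mg : measurable_fun B g.
    apply: measurable_funTS; apply: measurable_fun_ifT => //; apply: (measurable_fun_bool true).
    rewrite setTI [X in measurable X](_ : _ = D)//.
    by apply/seteqP; split=> y /=; [move/set_mem|move/mem_set].
  have -> : (eps%:E * PX B = \int[PX]_(y in B) g y)%E.
    rewrite -integral_cst//; apply: ae_eq_integral => //.
    exists (~` D); split => //; first exact: measurableC.
    by move=> y /= + Dy; apply => By; rewrite /g mem_set.
  apply: le_integral_nonmeasurable => // y By; rewrite /g.
  case: ifPn => [/set_mem Dy|_]; last by rewrite leey.
  rewrite lee_fin distrC ltW// near_x//.
  by rewrite (le_lt_trans By)// lte_fin.
apply/andP; split.
  rewrite mule_ge0//; first by rewrite lee_fin invr_ge0 ltW.
  exact: integral_ge0.
rewrite /ball_average muleC lee_pdivrMr//.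
by rewrite (le_trans int_le)// fineK.
Qed.

Lemma ball_average_cvg0 x : D x -> ball_support x ->
  has_average_limit PX dist D eta x 0%E.
Proof.
move=> Dx supp_x; split=> //.
  by near=> r; apply: supp_x.
have near_le eps : 0 < eps -> \forall r \near 0^'+,
    (0 <= ball_average PX dist eta x r <= eps%:E)%E.
  move=> eps_gt0; have [r0 r0_gt0 avg_le] := ball_average_le Dx eps_gt0.
  near=> r; apply: avg_le => //; exact: supp_x.
(* The bound with [eps = 1] gives finiteness near 0, which reduces the limit to one of reals. *)
apply/fine_cvgP; split.
  near=> r.
  have /andP[avg_ge0 avg_le1] : (0 <= ball_average PX dist eta x r <= 1)%E.
    by near: r; exact: near_le.
  by rewrite ge0_fin_numE// (le_lt_trans avg_le1)// ltry.
apply/cvgr0Pnorm_le => eps eps_gt0; near=> r.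
have /andP[] : (0 <= ball_average PX dist eta x r <= eps%:E)%E.
  by near: r; exact: near_le.
rewrite /=; case: (ball_average PX dist eta x r) => //= s.
by rewrite !lee_fin => s_ge0; rewrite ger0_norm.
Unshelve. all: by end_near. Qed.

(** At points of [D] in the support the limit is 0; at any other point no limit is admissible, so
    the point is vacuously bad. *)
Lemma besicovitch_bad_setE eps : 0 < eps ->
  besicovitch_bad_set PX dist D eta eps = ~` (D `&` ball_support).
Proof.
move=> eps_gt0; apply/seteqP; split=> x /=.
  move=> bad [Dx supp_x]; have := bad _ (ball_average_cvg0 Dx supp_x).
  by rewrite lte_fin ltNge ltW.
move=> xND l [Dx ball_gt0 _]; exfalso; apply: xND; split=> // r r_gt0.
(* Closed balls grow with the radius, so positive mass at one smaller radius [r'] suffices. *)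
have [r' [[r'_gt0 r'_lt] ball'_gt0]] : exists r', (0 < r' /\ r' < r) /\
    (0 < PX (closed_ball_wrt dist x r'))%E.
  near (0 : R)^'+ => r'; exists r'; split; last by near: r'.
  by split=> //; near: r'; exact: nbhs_right_lt.
apply: lt_le_trans ball'_gt0 _; apply: le_measure; rewrite ?inE//.
by move=> y /= /le_trans; apply; rewrite lee_fin ltW.
Unshelve. all: by end_near. Qed.

Lemma besicovitch_of_continuity : besicovitch_condition PX dist D eta.
Proof.
have mG : measurable (~` (D `&` ball_support)).
  by apply: measurableC; exact: measurableI.
split=> [eps /besicovitch_bad_setE -> //|].
apply: cvg_near_cst; near=> eps; rewrite besicovitch_bad_setE//.
apply/eqP; rewrite -measure_le0 setCI.
apply: (le_trans (measureU2 _ _ _)); try exact: measurableC.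
have PX0 : (PX (~` D) + PX (~` ball_support) = 0)%E.
  by rewrite PXD PXsupp adde0.
by rewrite le_eqVlt; apply/orP; left; apply/eqP.
Unshelve. all: by end_near. Qed.

End besicovitch_of_continuity.

Theorem proposition4 (R : realType) (S : pmetricType R)
  (sepS : separable_space S)
  (bndS : has_ubound (distances S))
  (diamS : 0 < diam S)
  (nu : {finite_measure set (borel S) -> \bar R})
  (d : measure_display) (Omega : measurableType d) (P : probability Omega R)
  (M : nat)
  (X : {RV P >-> config_space S})
  (Y : Omega -> 'I_M.+1)
  (mY : forall j : 'I_M.+1, measurable (Y @^-1` [set j]))
  (p : 'I_M.+1 -> R)
  (pE : forall j, P (Y @^-1` [set j]) = (p j)%:E)
  (p_gt0 : forall j, 0 < p j)
  (lambda : 'I_M.+1 -> S -> R)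
  (lambda_ge0 : forall j s, 0 <= lambda j s)
  (lambda_int : forall j, nu.-integrable setT
                  (fun s : borel S => (lambda j s)%:E))
  (XY : forall j, poisson_process nu (lambda j)
                    (cond_probability P (mY j)) X)
  (d0 : {fset S} -> {fset S} -> R)
  (d0_range : forall x y, 0 <= d0 x y <= 1)
  (d0_card : forall x y : {fset S}, #|` x| = #|` y| -> d0 x y = 0)
  (d0_sym : forall x y, d0 x y = d0 y x)
  (d0_triangle : forall x y z, d0 x z <= d0 x y + d0 y z)
  (d0_sep : forall x : {fset S}, exists2 eps0 : R, 0 < eps0 &
     forall y : {fset S}, d0 x y < eps0 -> #|` x| = #|` y|)
  (lambda_cont : forall j, continuous (lambda j)) :
  continuous_on_wrt (config_dist d0)
    (regression_domain nu p lambda) (regression nu p lambda) /\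
  besicovitch_condition (distribution P X) (config_dist d0)
    (regression_domain nu p lambda) (regression nu p lambda).
Proof.
have D_cont : continuous_on_wrt (config_dist d0)
    (regression_domain nu p lambda) (regression nu p lambda).
  exact: regression_continuous.
have m_ball x r : measurable (closed_ball_wrt (config_dist d0) x r).
  exact: measurable_config_ball.
have [q q_dense] := separable_dense_seq sepS.
have := null_ball_basic diamS d0_range d0_card d0_triangle d0_sep
  (distribution P X) q_dense.
(* The set of points having a null ball is by conversion the complement of [ball_support]. *)
rewrite -[LHS]/(~` ball_support (distribution P X) (config_dist d0)) => suppE.
have [mN N0] := countable_bigcup_null (distribution P X)
  (measurable_basic_nbhd q).
split=> //; apply: besicovitch_of_continuity => //.
- exact: measurable_regression_domain.
- exact: (regression_domain_full p_gt0 lambda_ge0 lambda_cont (mY := mY)).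
- by rewrite -[ball_support _ _]setCK suppE; exact: measurableC.
- by rewrite suppE.
Qed.
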